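(* Let $((A,\rho_A);(B,\rho_B))$ be an $E$-Lie bialgebroid over $M$, and define on $\Gamma(E)$ the bracket $[u,v]_E=\langle d^Au,d^Bv\rangle_E\ (=\rho_B(d^Au)v)$, $u,v\in\Gamma(E)$. 1) If $\mathrm{rank}(E)\ge2$, then $(E,[\cdot,\cdot]_E)$ is a Lie algebroid with anchor $j\circ\rho_B\circ\rho_A^\star\circ\mathbf d$. 2) If $\mathrm{rank}(E)=1$, then $(E,[\cdot,\cdot]_E)$ is a local Lie algebra.
   Context: **Bundles.** $\mathfrak DE$ is the gauge Lie algebroid of $E$: its sections are the $\mathbb R$-linear $\mathfrak d:\Gamma(E)\to\Gamma(E)$ for which there is a vector field $j(\mathfrak d)$ with $\mathfrak d(fu)=f\mathfrak d(u)+j(\mathfrak d)(f)u$; bracket = commutator, anchor $j:\mathfrak DE\to TM$. The first jet bundle $\mathfrak JE$ is regarded as a subbundle of $\mathrm{Hom}(\mathfrak DE,E)$, the jet $[u]_m$ corresponding to $\mathfrak d\mapsto\mathfrak d(u)(m)$; $\mathbf d:\Gamma(E)\to\Gamma(\mathfrak JE)$ is $(\mathbf du)(\mathfrak d)=\mathfrak d(u)$. **$E$-duality.** For vector bundles $A,E$ over $M$, a subbundle $B\subset\mathrm{Hom}(A,E)$ is an $E$-dual bundle of $A$ if the pairing $\langle a,b\rangle_E=b(a)$ is nondegenerate (on both sides); then also $A\subset\mathrm{Hom}(B,E)$. Set $\mathrm{Hom}(\wedge^0A,E)_B=E$, $\mathrm{Hom}(\wedge^1A,E)_B=B$, and for $k\ge2$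 let $\mathrm{Hom}(\wedge^kA,E)_B$ consist of the $\mu\in\mathrm{Hom}(\wedge^kA,E)$ with $\mu(X_1,\dots,X_{k-1},\cdot)\in B$ for all $X_i$; similarly $\mathrm{Hom}(\wedge^kB,E)_A$. If $A$ is a Lie algebroid with representation $\rho_A:A\to\mathfrak DE$, $d^A$ is the Chevalley–Eilenberg coboundary on $\Gamma(\mathrm{Hom}(\wedge^\bullet A,E))$; $\rho_A$ is $B$-invariant if $\Gamma(\mathrm{Hom}(\wedge^\bullet A,E)_B)$ is a subcomplex. Then $\rho_A^\star:\mathfrak JE\to B$, $\rho_A^\star(\mu)(X)=\mu(\rho_A(X))$, and $\rho_A^\star(\mathbf du)=d^Au$. An $E$-dual pair of Lie algebroids $((A,\rho_A);(B,\rho_B))$ consists of Lie algebroids $A,B$ that are mutually $E$-dual, a $B$-invariant representation $\rho_A:A\to\mathfrak DE$ and an $A$-invariant representation $\rho_B:B\to\mathfrak DE$. **Lie derivatives.** For $X,Y\in\Gamma(A)$, $\xi\in\Gamma(B)$: $\mathcal L_Xu=\rho_A(X)u$, $\mathcal L_XY=[X,Y]$, $\langle\mathcal L_X\xi,Y\rangle_E=\rho_A(X)\langle\xi,Y\rangle_E-\langle\xi,[X,Y]\rangle_E$, and for $\Xi\in\Gamma(\mathrm{Hom}(\wedge^kB,E)_A)$, $(\mathcal L_X\Xi)(\xi_1,\dots,\xi_k)=\rho_A(X)(\Xi(\xi_1,\dots,\xi_k))-\sum_i\Xi(\xi_1,\dots,\mathcal L_X\xi_i,\dots,\xi_k)$;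 analogously for $\mathcal L_\xi$, exchanging $A$ and $B$. **$E$-Lie bialgebroid.** An $E$-dual pair such that for all $X,Y\in\Gamma(A)$, $u\in\Gamma(E)$: (1) $d^B[X,Y]=\mathcal L_X(d^BY)-\mathcal L_Y(d^BX)$; (2) $\mathcal L_{d^Au}X=-\mathcal L_{d^Bu}X$; (3) $\langle d^Bu,d^Au\rangle_E=0$. (Here $d^Au\in\Gamma(B)$, $d^Bu\in\Gamma(A)$.) A local Lie algebra is a vector bundle $E$ with an $\mathbb R$-Lie algebra bracket on $\Gamma(E)$ satisfying $\mathrm{supp}[u,v]\subset\mathrm{supp}\,u\cap\mathrm{supp}\,v$. *)

(* Defs.v *)
From HB Require Import structures.
From mathcomp Require Import all_boot all_order all_algebra.
From mathcomp Require Import boolp classical_sets functions.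
From mathcomp Require Import reals topology normedtype derive.

Set Implicit Arguments.
Unset Strict Implicit.
Unset Printing Implicit Defensive.

Import Order.TTheory GRing.Theory Num.Theory.
Import numFieldNormedType.Exports.
Local Open Scope classical_set_scope.
Local Open Scope ring_scope.

Section Euclidean.
Context {R : realType} {n : nat}.
Implicit Types (U V : set 'rV[R]_n) (f g : 'rV[R]_n -> R).

Definition partial (i : 'I_n) f : 'rV[R]_n -> R := fun x => 'D_(delta_mx 0 i) f x.

Fixpoint Ck (k : nat) U f : Prop :=
  (forall x, U x -> {for x, continuous f}) /\
  (if k is k'.+1 then
     forall i, (forall x, U x -> derivable f x (delta_mx 0 i)) /\
               Ck k' U (partial i f)
   else True).

Definition Cinfty U f : Prop := forall k, Ck k U f.

Lemma Ck_sub k U V f : U `<=` V -> Ck k V f -> Ck k U f.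
Proof.
move=> UV; elim: k f => [|k IH] f /= [fc fk]; split=> //.
- by move=> x /UV/fc.
- by move=> x /UV/fc.
move=> i; have [fd fi] := fk i; split; [by move=> x /UV/fd | exact: IH].
Qed.

Lemma Ck_pred k U f : Ck k.+1 U f -> Ck k U f.
Proof.
elim: k f => [|k IH] f [fc fk]; split=> // i.
by have [fd fi] := fk i; split=> //; exact: IH.
Qed.

Lemma near_open U f g x : open U -> U x -> (forall y, U y -> f y = g y) ->
  \near x, f x = g x.
Proof.
move=> oU Ux fg; apply: filterS (open_nbhs_nbhs (conj oU Ux)) => y; exact: fg.
Qed.

Lemma continuous_ext U f g x : open U -> U x -> (forall y, U y -> f y = g y) ->
  {for x, continuous f} -> {for x, continuous g}.
Proof.
move=> oU Ux fg fc; rewrite /prop_for /continuous_at -(fg _ Ux).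
apply: cvg_trans fc; apply: (near_eq_cvg (F := nbhs x)).
exact: near_open oU Ux fg.
Qed.

Lemma Ck_ext k U f g : open U -> (forall x, U x -> f x = g x) ->
  Ck k U f -> Ck k U g.
Proof.
move=> oU; elim: k f g => [|k IH] f g fg /= [fc fk].
  by split=> // x Ux; exact: continuous_ext oU Ux fg (fc x Ux).
split=> [x Ux|i]; first exact: continuous_ext oU Ux fg (fc x Ux).
have [fd fi] := fk i; split=> [x Ux|].
  by apply: near_eq_derivable (fd x Ux); exact: near_open oU Ux fg.
apply: IH fi => x Ux; apply: near_eq_derive; exact: near_open oU Ux fg.
Qed.

Lemma Ck_cst k U (c : R) : Ck k U (fun=> c).
Proof.
elim: k c => [|k IH] c; first by split=> // x _; exact: (@cst_continuous _ _ c x).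
split=> [x _|i]; first exact: (@cst_continuous _ _ c x).
split=> [x _|]; first exact: derivable_cst.
rewrite (_ : partial i _ = fun=> 0); first exact: IH.
by apply/funext => x; exact: derive_cst.
Qed.

Lemma Ck_add k U f g : open U -> Ck k U f -> Ck k U g ->
  Ck k U (fun x => f x + g x).
Proof.
move=> oU; elim: k f g => [|k IH] f g /= [fc fk] [gc gk].
  by split=> // x Ux; apply: (@continuousD R _ _ f g x) => //; [exact: fc|exact: gc].
split=> [x Ux|i].
  by apply: (@continuousD R _ _ f g x) => //; [exact: fc|exact: gc].
have [fd fi] := fk i; have [gd gi] := gk i; split=> [x Ux|].
  by apply: derivableD; [exact: fd|exact: gd].
apply: (Ck_ext oU) (IH _ _ fi gi) => x Ux.
by rewrite /partial (@deriveD _ _ _ f g) //; [exact: fd|exact: gd].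
Qed.

Lemma Ck_mul k U f g : open U -> Ck k U f -> Ck k U g ->
  Ck k U (fun x => f x * g x).
Proof.
move=> oU; elim: k f g => [|k IH] f g Hf Hg.
  case: Hf Hg => [fc _] [gc _].
  by split=> // x Ux; apply: (@continuousM _ _ f g x); [exact: fc|exact: gc].
have [fc fk] := Hf; have [gc gk] := Hg.
split=> [x Ux|i]; first by apply: (@continuousM _ _ f g x); [exact: fc|exact: gc].
have [fd fi] := fk i; have [gd gi] := gk i; split=> [x Ux|].
  by apply: derivableM; [exact: fd|exact: gd].
apply: (@Ck_ext _ _ (fun x => f x * partial i g x + g x * partial i f x) _ oU).
  move=> x Ux; rewrite /partial (@deriveM _ _ f g) //; [exact: fd|exact: gd].
apply: Ck_add => //; apply: IH => //; exact: Ck_pred.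
Qed.

End Euclidean.

Record chart (R : realType) (n : nat) (M : topologicalType) := Chart {
  chart_dom : set M;
  chart_img : set 'rV[R]_n;
  chart_map : M -> 'rV[R]_n;
  chart_inv : 'rV[R]_n -> M;
  chart_dom_open : open chart_dom;
  chart_img_open : open chart_img;
  chart_map_img : forall p, chart_dom p -> chart_img (chart_map p);
  chart_inv_dom : forall x, chart_img x -> chart_dom (chart_inv x);
  chart_mapK : forall p, chart_dom p -> chart_inv (chart_map p) = p;
  chart_invK : forall x, chart_img x -> chart_map (chart_inv x) = x;
  chart_map_cont : forall p, chart_dom p -> {for p, continuous chart_map};
  chart_inv_cont : forall x, chart_img x -> {for x, continuous chart_inv} }.

Record manifold (R : realType) (n : nat) := Manifold {
  carrier :> topologicalType;
  mfd_hausdorff : hausdorff_space carrier;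
  mfd_second_countable : @second_countable carrier;
  atlas : set (chart R n carrier);
  atlas_cover : forall p, exists2 c, atlas c & chart_dom c p;
  atlas_compat : forall c c', atlas c -> atlas c' -> forall i : 'I_n,
    Cinfty (chart_img c `&` chart_inv c @^-1` chart_dom c')
      (fun x => chart_map c' (chart_inv c x) 0 i) }.

Section SmoothFunctions.
Context {R : realType} {n : nat} {M : manifold R n}.
Implicit Types (U V : set M) (f g : M -> R).

Definition smooth_on U f : Prop := forall c, atlas c ->
  Cinfty (chart_img c `&` chart_inv c @^-1` U) (f \o chart_inv c).

Lemma chart_open (c : chart R n M) U : open U ->
  open (chart_img c `&` chart_inv c @^-1` U).
Proof.
move=> oU; rewrite openE => x [cx Ux]; apply: filterI.
  by apply: open_nbhs_nbhs; split=> //; exact: chart_img_open.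
by apply: (chart_inv_cont cx); exact: open_nbhs_nbhs.
Qed.

Lemma smooth_on_sub U V f : U `<=` V -> smooth_on V f -> smooth_on U f.
Proof. by move=> UV fV c ac k; apply: Ck_sub (fV c ac k) => x [? /UV]. Qed.

Lemma smooth_on_cst U (a : R) : smooth_on U (fun=> a).
Proof. by move=> c _ k; exact: Ck_cst. Qed.

Lemma smooth_on_add U f g : open U -> smooth_on U f -> smooth_on U g ->
  smooth_on U (fun p => f p + g p).
Proof.
move=> oU fU gU c ac k.
exact: (Ck_add (chart_open oU) (fU c ac k) (gU c ac k)).
Qed.

Lemma smooth_on_mul U f g : open U -> smooth_on U f -> smooth_on U g ->
  smooth_on U (fun p => f p * g p).
Proof.
move=> oU fU gU c ac k.
exact: (Ck_mul (chart_open oU) (fU c ac k) (gU c ac k)).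
Qed.

End SmoothFunctions.

Record smooth_fun (R : realType) (n : nat) (M : manifold R n) := SmoothFun {
  smooth_val :> M -> R;
  smooth_valP : smooth_on setT smooth_val }.

Notation "''C^oo' M" := (smooth_fun M) (at level 8, M at level 2).

Section SmoothRing.
Context {R : realType} {n : nat} {M : manifold R n}.
Implicit Types f g h : 'C^oo M.

Lemma smooth_funP f g : f =1 g -> f = g.
Proof.
case: f g => [f fP] [g gP] /= /funext fg; case: _ / fg in gP *.
by congr SmoothFun; exact: Prop_irrelevance.
Qed.

HB.instance Definition _ := gen_eqMixin 'C^oo M.
HB.instance Definition _ := gen_choiceMixin 'C^oo M.

Definition smooth_cst (a : R) : 'C^oo M := SmoothFun (smooth_on_cst (M := M) setT a).
Definition smooth_add f g : 'C^oo M :=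
  SmoothFun (smooth_on_add openT (smooth_valP f) (smooth_valP g)).
Definition smooth_mul f g : 'C^oo M :=
  SmoothFun (smooth_on_mul openT (smooth_valP f) (smooth_valP g)).
Definition smooth_opp f : 'C^oo M := smooth_mul (smooth_cst (- 1)) f.

Fact smooth_addA : associative smooth_add.
Proof. by move=> f g h; apply: smooth_funP => p /=; rewrite addrA. Qed.
Fact smooth_addC : commutative smooth_add.
Proof. by move=> f g; apply: smooth_funP => p /=; rewrite addrC. Qed.
Fact smooth_add0 : left_id (smooth_cst 0) smooth_add.
Proof. by move=> f; apply: smooth_funP => p /=; rewrite add0r. Qed.
Fact smooth_addN : left_inverse (smooth_cst 0) smooth_opp smooth_add.
Proof. by move=> f; apply: smooth_funP => p /=; rewrite mulN1r addNr. Qed.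

HB.instance Definition _ := GRing.isZmodule.Build 'C^oo M
  smooth_addA smooth_addC smooth_add0 smooth_addN.

Fact smooth_mulA : associative smooth_mul.
Proof. by move=> f g h; apply: smooth_funP => p /=; rewrite mulrA. Qed.
Fact smooth_mulC : commutative smooth_mul.
Proof. by move=> f g; apply: smooth_funP => p /=; rewrite mulrC. Qed.
Fact smooth_mul1 : left_id (smooth_cst 1) smooth_mul.
Proof. by move=> f; apply: smooth_funP => p /=; rewrite mul1r. Qed.
Fact smooth_mulD : left_distributive smooth_mul smooth_add.
Proof. by move=> f g h; apply: smooth_funP => p /=; rewrite mulrDl. Qed.

HB.instance Definition _ := GRing.Zmodule_isComPzRing.Build 'C^oo M
  smooth_mulA smooth_mulC smooth_mul1 smooth_mulD.

End SmoothRing.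

(* Outside of its domain, the two linear maps of a trivialization are junk. *)
Record trivialization (R : realType) (n : nat) (M : manifold R n) (r : nat)
    (F : M -> lmodType R) := Trivialization {
  triv_dom : set M;
  triv_map : forall p, {linear F p -> 'rV[R]_r};
  triv_inv : forall p, {linear 'rV[R]_r -> F p};
  triv_dom_open : open triv_dom;
  triv_mapK : forall p, triv_dom p -> cancel (triv_map p) (triv_inv p);
  triv_invK : forall p, triv_dom p -> cancel (triv_inv p) (triv_map p) }.

Record vbundle (R : realType) (n : nat) (M : manifold R n) := VBundle {
  rank : nat;
  fiber :> M -> lmodType R;
  trivs : set (trivialization rank fiber);
  trivs_cover : forall p, exists2 t, trivs t & triv_dom t p;
  trivs_compat : forall t t', trivs t -> trivs t' ->
    forall (v : 'rV[R]_rank) (i : 'I_rank),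
    smooth_on (triv_dom t `&` triv_dom t')
      (fun p => triv_map t' p (triv_inv t p v) 0 i) }.

Definition smooth_section (R : realType) (n : nat) (M : manifold R n)
    (E : vbundle M) (s : forall p, E p) : Prop :=
  forall t, trivs t -> forall i : 'I_(rank E),
    smooth_on (triv_dom t) (fun p => triv_map t p (s p) 0 i).

Record section (R : realType) (n : nat) (M : manifold R n) (E : vbundle M) :=
  MkSection {
  section_val :> forall p, E p;
  section_valP : smooth_section section_val }.

Notation "''Gamma' E" := (section E) (at level 8, E at level 2).

Section SectionModule.
Context {R : realType} {n : nat} {M : manifold R n} {E : vbundle M}.
Implicit Types (s t u : 'Gamma E) (f g : 'C^oo M).

Lemma sectionP s t : (forall p, s p = t p) -> s = t.
Proof.
case: s t => [s sP] [t tP] /= st.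
have {st} e : s = t by exact: functional_extensionality_dep.
case: _ / e in tP *.
by congr MkSection; exact: Prop_irrelevance.
Qed.

HB.instance Definition _ := gen_eqMixin 'Gamma E.
HB.instance Definition _ := gen_choiceMixin 'Gamma E.

Fact section_zero_smooth : smooth_section (E := E) (fun p => 0).
Proof.
move=> t _ i; rewrite (_ : (fun p => _) = fun=> 0); first exact: smooth_on_cst.
by apply/funext => p; rewrite linear0 mxE.
Qed.
Fact section_add_smooth s t : smooth_section (fun p => s p + t p).
Proof.
move=> e et i; rewrite (_ : (fun p => _) =
  fun p => triv_map e p (s p) 0 i + triv_map e p (t p) 0 i).
  apply: smooth_on_add; first exact: triv_dom_open; exact: section_valP.
by apply/funext => p; rewrite linearD mxE.
Qed.
Fact section_scale_smooth f s : smooth_section (fun p => f p *: s p).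
Proof.
move=> e et i; rewrite (_ : (fun p => _) =
  fun p => f p * triv_map e p (s p) 0 i).
  apply: smooth_on_mul; first exact: triv_dom_open.
    by apply: smooth_on_sub (smooth_valP f).
  exact: section_valP.
by apply/funext => p; rewrite linearZ mxE.
Qed.

Definition section_zero : 'Gamma E := MkSection section_zero_smooth.
Definition section_add s t : 'Gamma E := MkSection (section_add_smooth s t).
Definition section_scale f s : 'Gamma E := MkSection (section_scale_smooth f s).
Definition section_opp s : 'Gamma E := section_scale (smooth_cst (- 1)) s.

Fact section_addA : associative section_add.
Proof. by move=> s t u; apply: sectionP => p /=; rewrite addrA. Qed.
Fact section_addC : commutative section_add.
Proof. by move=> s t; apply: sectionP => p /=; rewrite addrC. Qed.
Fact section_add0 : left_id section_zero section_add.
Proof. by move=> s; apply: sectionP => p /=; rewrite add0r. Qed.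
Fact section_addN : left_inverse section_zero section_opp section_add.
Proof. by move=> s; apply: sectionP => p /=; rewrite scaleN1r addNr. Qed.

HB.instance Definition _ := GRing.isZmodule.Build 'Gamma E
  section_addA section_addC section_add0 section_addN.

Fact section_scaleA f g s :
  section_scale f (section_scale g s) = section_scale (f * g) s.
Proof. by apply: sectionP => p /=; rewrite scalerA. Qed.
Fact section_scale1 : left_id 1 section_scale.
Proof. by move=> s; apply: sectionP => p /=; rewrite scale1r. Qed.
Fact section_scaleDr : right_distributive section_scale +%R.
Proof. by move=> f s t; apply: sectionP => p /=; rewrite scalerDr. Qed.
Fact section_scaleDl s : {morph section_scale^~ s : f g / f + g}.
Proof. by move=> f g; apply: sectionP => p /=; rewrite scalerDl. Qed.

HB.instance Definition _ := GRing.Zmodule_isLmodule.Build 'C^oo M 'Gamma E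
  section_scaleA section_scale1 section_scaleDr section_scaleDl.

Definition support s : set M := closure [set p | s p != 0].

End SectionModule.

(* The fibre of TM at p, and the sections of TM: point derivations and
   derivations of the algebra of smooth functions. *)
Record tangent (R : realType) (n : nat) (M : manifold R n) (p : M) := Tangent {
  tangent_val :> 'C^oo M -> R;
  tangent_linear : forall (c : R) f g,
    tangent_val (smooth_cst c * f + g) = c * tangent_val f + tangent_val g;
  tangent_leibniz : forall f g,
    tangent_val (f * g) = tangent_val f * g p + f p * tangent_val g }.

Record vector_field (R : realType) (n : nat) (M : manifold R n) := VectorField {
  vf_val :> 'C^oo M -> 'C^oo M;
  vf_linear : forall (c : R) f g,
    vf_val (smooth_cst c * f + g) = smooth_cst c * vf_val f + vf_val g;
  vf_leibniz : forall f g, vf_val (f * g) = vf_val f * g + f * vf_val g }.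

(* The fibre of the gauge algebroid of E at p, and its sections. *)
Record gauge_at (R : realType) (n : nat) (M : manifold R n) (E : vbundle M)
    (p : M) := GaugeAt {
  gauge_at_val :> 'Gamma E -> E p;
  gauge_at_linear : forall (c : R) u v,
    gauge_at_val (smooth_cst c *: u + v) = c *: gauge_at_val u + gauge_at_val v;
  gauge_at_symbol : exists x : tangent p, forall f u,
    gauge_at_val (f *: u) = f p *: gauge_at_val u + x f *: u p }.

Record gauge (R : realType) (n : nat) (M : manifold R n) (E : vbundle M) :=
  Gauge {
  gauge_val :> 'Gamma E -> 'Gamma E;
  gauge_linear : forall (c : R) u v,
    gauge_val (smooth_cst c *: u + v) = smooth_cst c *: gauge_val u + gauge_val v;
  gauge_symbol : exists X : vector_field M, forall f u,
    gauge_val (f *: u) = f *: gauge_val u + X f *: u }.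

(* The map j; its value is determined by d as soon as rank E > 0. *)
Definition symbol (R : realType) (n : nat) (M : manifold R n) (E : vbundle M)
  (d : gauge E) : vector_field M := sval (cid (gauge_symbol d)).

(* Sections of the first jet bundle, as a subbundle of Hom(DE, E). *)
Record jet_section (R : realType) (n : nat) (M : manifold R n) (E : vbundle M) :=
  JetSection {
  jet_val :> gauge E -> 'Gamma E;
  jet_valP : forall p, exists u : 'Gamma E, forall d, jet_val d p = d u p }.

Definition jet (R : realType) (n : nat) (M : manifold R n) (E : vbundle M)
    (u : 'Gamma E) : jet_section E :=
  @JetSection R n M E (fun d => d u) (fun p => ex_intro _ u (fun d => erefl)).

Section LieStructures.
Context {R : realType} {n : nat} {M : manifold R n}.

Definition lie_bracket (E : vbundle M) (br : 'Gamma E -> 'Gamma E -> 'Gamma E) :=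
  [/\ forall (c : R) X Y Z,
        br (smooth_cst c *: X + Y) Z = smooth_cst c *: br X Z + br Y Z,
      forall (c : R) X Y Z,
        br X (smooth_cst c *: Y + Z) = smooth_cst c *: br X Y + br X Z,
      forall X, br X X = 0
    & forall X Y Z, br X (br Y Z) + br Y (br Z X) + br Z (br X Y) = 0].

Definition local_lie_algebra (E : vbundle M)
    (br : 'Gamma E -> 'Gamma E -> 'Gamma E) : Prop :=
  lie_bracket br /\
  forall u v, support (br u v) `<=` support u `&` support v.

Definition bundle_map_to_TM (E : vbundle M) (a : 'Gamma E -> vector_field M) :=
  exists a_ : forall p, E p -> tangent p,
    (forall p (c : R) x y f, a_ p (c *: x + y) f = c * a_ p x f + a_ p y f) /\
    (forall X f p, a X f p = a_ p (X p) f).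

Definition is_lie_algebroid (E : vbundle M)
    (br : 'Gamma E -> 'Gamma E -> 'Gamma E) (a : 'Gamma E -> vector_field M) :=
  [/\ lie_bracket br,
      bundle_map_to_TM a,
      forall X Y f, a (br X Y) f = a X (a Y f) - a Y (a X f)
    & forall X Y f, br X (f *: Y) = f *: br X Y + a X f *: Y].

Definition bundle_map_to_DE (A E : vbundle M) (r : 'Gamma A -> gauge E) :=
  exists r_ : forall p, A p -> gauge_at E p,
    (forall p (c : R) x y u, r_ p (c *: x + y) u = c *: r_ p x u + r_ p y u) /\
    (forall X u p, r X u p = r_ p (X p) u).

End LieStructures.

Record lie_algebroid (R : realType) (n : nat) (M : manifold R n) :=
  LieAlgebroid {
  la_bundle :> vbundle M;
  la_bracket : 'Gamma la_bundle -> 'Gamma la_bundle -> 'Gamma la_bundle;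
  anchor : 'Gamma la_bundle -> vector_field M;
  la_axioms : is_lie_algebroid la_bracket anchor }.

Record representation (R : realType) (n : nat) (M : manifold R n)
    (A : lie_algebroid M) (E : vbundle M) := Representation {
  rep_val :> 'Gamma A -> gauge E;
  rep_bundle_map : bundle_map_to_DE rep_val;
  rep_anchor : forall X f, symbol (rep_val X) f = anchor X f;
  rep_bracket : forall X Y u, rep_val (la_bracket X Y) u =
    rep_val X (rep_val Y u) - rep_val Y (rep_val X u) }.

(* B as an E-dual bundle of A: the inclusion of B in Hom(A, E) is given by the
   pairing, which is symmetric in A and B up to the order of arguments. *)
Record edual (R : realType) (n : nat) (M : manifold R n) (A B E : vbundle M) :=
  EDual {
  epair : forall p, A p -> B p -> E p;
  epair_linearl : forall p (c : R) x x' y,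
    epair (c *: x + x') y = c *: epair x y + epair (p := p) x' y;
  epair_linearr : forall p (c : R) x y y',
    epair x (c *: y + y') = c *: epair x y + epair (p := p) x y';
  epair_smooth : forall (X : 'Gamma A) (xi : 'Gamma B),
    smooth_section (E := E) (fun p => epair (X p) (xi p));
  epair_nondegl : forall p (x : A p), (forall y, epair x y = 0) -> x = 0;
  epair_nondegr : forall p (y : B p), (forall x, epair x y = 0) -> y = 0 }.

Definition edual_flip (R : realType) (n : nat) (M : manifold R n)
    (A B E : vbundle M) (P : edual A B E) : edual B A E :=
  @EDual R n M B A E (fun p y x => epair P x y)
    (fun p c y y' x => epair_linearr P c x y y')
    (fun p c y x x' => epair_linearl P c x x' y)
    (fun xi X => epair_smooth P X xi)
    (epair_nondegr (e := P)) (epair_nondegl (e := P)).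

Section Cochains.
Context {R : realType} {n : nat} {M : manifold R n}.

Definition cochain (A E : vbundle M) (k : nat) := ('I_k -> 'Gamma A) -> 'Gamma E.

(* mu is induced by a family of alternating multilinear maps on the fibres,
   that is, mu is a section of Hom(/\^k A, E). *)
Definition is_form (A E : vbundle M) (k : nat) (mu : cochain A E k) : Prop :=
  exists w : forall p, ('I_k -> A p) -> E p,
    [/\ forall p (x : 'I_k -> A p) i (c : R) y z,
          w p [eta x with i |-> c *: y + z] =
          c *: w p [eta x with i |-> y] + w p [eta x with i |-> z],
        forall p (x : 'I_k -> A p) i j, i != j -> x i = x j -> w p x = 0
      & forall X p, mu X p = w p (fun i => X i p)].

Section Pairing.
Context {A B E : vbundle M} (P : edual A B E).

Definition spair (X : 'Gamma A) (xi : 'Gamma B) : 'Gamma E :=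
  MkSection (epair_smooth P X xi).

(* Sections of Hom(/\^k A, E)_B; the condition is void for k = 0. *)
Definition in_Hom_dual (k : nat) (mu : cochain A E k) : Prop :=
  is_form mu /\
  forall i : 'I_k, i.+1 = k -> forall X : 'I_k -> 'Gamma A,
    exists xi : 'Gamma B, forall Y, mu [eta X with i |-> Y] = spair Y xi.

(* The section of B that represents phi : A -> E, if there is one (it is
   unique, by nondegeneracy); otherwise the zero section. *)
Definition represent (phi : 'Gamma A -> 'Gamma E) : 'Gamma B :=
  xget 0 [set xi | forall X, spair X xi = phi X].

Definition one_form (xi : 'Gamma B) : cochain A E 1 :=
  fun X => spair (X ord0) xi.

End Pairing.

Section Differential.
Context {A : lie_algebroid M} {E : vbundle M} (rho : representation A E).

(* The arguments ([X_i, X_j], X_0, .., X_k) with X_i and X_j left out; only used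
   for i < j, when this list has length k. *)
Definition bracket_args (k : nat) (X : 'I_k.+1 -> 'Gamma A) (i j : 'I_k.+1) :
    'I_k -> 'Gamma A :=
  fun l => nth 0 (la_bracket (X i) (X j) ::
                  [seq X m | m <- enum 'I_k.+1 & (m != i) && (m != j)]) l.

Definition ce_diff (k : nat) (mu : cochain A E k) : cochain A E k.+1 := fun X =>
  \sum_(i < k.+1) (-1) ^+ i *: rho (X i) (mu (fun l => X (lift i l))) +
  \sum_(i < k.+1) \sum_(j < k.+1 | (i < j)%N)
    (-1) ^+ (i + j) *: mu (bracket_args X i j).

Definition invariant_rep (B : vbundle M) (P : edual A B E) : Prop :=
  forall k (mu : cochain A E k), in_Hom_dual P mu -> in_Hom_dual P (ce_diff mu).

Context {B : vbundle M} (P : edual A B E).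

(* d^A u, seen as a section of B (see diff0P below). *)
Definition diff0 (u : 'Gamma E) : 'Gamma B :=
  represent P (fun X => @ce_diff 0 (fun=> u) (fun=> X)).

Definition rep_star (mu : jet_section E) : 'Gamma B :=
  represent P (fun X => mu (rho X)).

(* The Lie derivative L_X on sections of B (see lie_dualP below) and on
   sections of Hom(/\^k B, E)_A. *)
Definition lie_dual (X : 'Gamma A) (xi : 'Gamma B) : 'Gamma B :=
  represent P (fun Y => rho X (spair P Y xi) - spair P (la_bracket X Y) xi).

Definition lie_cochain (k : nat) (X : 'Gamma A) (Xi : cochain B E k) :
    cochain B E k := fun xi =>
  rho X (Xi xi) - \sum_(i < k) Xi [eta xi with i |-> lie_dual X (xi i)].

End Differential.
End Cochains.

Section Bialgebroid.
Context {R : realType} {n : nat} {M : manifold R n}.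
Context {A B : lie_algebroid M} {E : vbundle M} (P : edual A B E).
Context (rhoA : representation A E) (rhoB : representation B E).

Definition E_dual_pair : Prop :=
  invariant_rep rhoA P /\ invariant_rep rhoB (edual_flip P).

Let dA : 'Gamma E -> 'Gamma B := diff0 rhoA P.
Let dB : 'Gamma E -> 'Gamma A := diff0 rhoB (edual_flip P).
Let dB1 (X : 'Gamma A) : cochain B E 2 :=
  ce_diff rhoB (one_form (edual_flip P) X).

Definition E_Lie_bialgebroid : Prop :=
  [/\ E_dual_pair,
      forall (X Y : 'Gamma A) (xi : 'I_2 -> 'Gamma B),
        dB1 (la_bracket X Y) xi =
        lie_cochain rhoA P X (dB1 Y) xi - lie_cochain rhoA P Y (dB1 X) xi,
      forall (X : 'Gamma A) (u : 'Gamma E),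
        lie_dual rhoB (edual_flip P) (dA u) X = - la_bracket (dB u) X
    & forall u : 'Gamma E, spair P (dB u) (dA u) = 0].

Definition bracketE (u v : 'Gamma E) : 'Gamma E := spair P (dB v) (dA u).

Definition anchorE (u : 'Gamma E) : vector_field M :=
  symbol (rhoB (rep_star rhoA P (jet u))).

End Bialgebroid.

Section Represent.
Context {R : realType} {n : nat} {M : manifold R n}.

Lemma representP (A B E : vbundle M) (P : edual A B E)
    (phi : 'Gamma A -> 'Gamma E) :
  (exists xi, forall X, spair P X xi = phi X) ->
  forall X, spair P X (represent P phi) = phi X.
Proof.
move=> [xi xiP]; rewrite /represent.
case: (xgetP 0 [set xi | forall X, spair P X xi = phi X]) => [y _ //|/(_ xi)].
by case.
Qed.

Context {A : lie_algebroid M} {B E : vbundle M} (P : edual A B E).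
Context (rho : representation A E).

Lemma ce_diff0E (u : 'Gamma E) X :
  ce_diff rho (fun _ : 'I_0 -> 'Gamma A => u) X = rho (X ord0) u.
Proof.
rewrite /ce_diff !big_ord_recl !big_ord0 big_mkcond big_ord_recl big_ord0 /=.
by rewrite expr0 scale1r !addr0.
Qed.

Lemma ce_diff1E (mu : cochain A E 1) (X : 'I_2 -> 'Gamma A) :
  ce_diff rho mu X = rho (X ord0) (mu (fun=> X ord_max)) -
    rho (X ord_max) (mu (fun=> X ord0)) -
    mu (fun=> la_bracket (X ord0) (X ord_max)).
Proof.
have lift01 : lift ord0 ord0 = ord_max :> 'I_2 by exact/val_inj.
have lift10 : lift ord_max ord0 = ord0 :> 'I_2 by exact/val_inj.
rewrite /ce_diff !big_ord_recl !big_ord0 /= !lift01.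
rewrite big_mkcond !big_ord_recl !big_ord0 big_mkcond !big_ord_recl !big_ord0.
rewrite /= !lift01 !addr0 !add0r expr0 expr1 scale1r !scaleN1r.
congr (rho _ _ - rho _ _ - _).
- by congr (mu _); apply/funext => l; rewrite (ord1 l) lift01.
- by congr (mu _); apply/funext => l; rewrite (ord1 l) lift10.
- by congr (mu _); apply/funext => l; rewrite (ord1 l).
Qed.

Context (rhoP : invariant_rep rho P).

Lemma in_Hom_dual0 (u : 'Gamma E) : @in_Hom_dual _ _ _ A B E P 0 (fun=> u).
Proof. by split=> [|[]//]; exists (fun p _ => u p); split=> // p x []. Qed.

Lemma in_Hom_dual1 (xi : 'Gamma B) : in_Hom_dual P (one_form P xi).
Proof.
split=> [|i _ X]; last first.
  by exists xi => Y; rewrite (ord1 i).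
exists (fun p x => epair P (x ord0) (xi p)); split=> // [p x i c y z|p x i j].
  by rewrite (ord1 i) /= epair_linearl.
by rewrite (ord1 i) (ord1 j).
Qed.

Lemma diff0P (u : 'Gamma E) X : spair P X (diff0 rho P u) = rho X u.
Proof.
rewrite /diff0 representP ?ce_diff0E //.
have [_ /(_ ord0 erefl (fun=> 0)) [xi xiP]] := rhoP (in_Hom_dual0 u).
by exists xi => Y; rewrite -xiP !ce_diff0E.
Qed.

Lemma rep_star_jet (u : 'Gamma E) : rep_star rho P (jet u) = diff0 rho P u.
Proof.
by congr (represent P _); apply/funext => X; rewrite ce_diff0E.
Qed.

Lemma lie_dualP X (xi : 'Gamma B) Y : spair P Y (lie_dual rho P X xi) =
  rho X (spair P Y xi) - spair P (la_bracket X Y) xi.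
Proof.
apply: representP.
have [_ /(_ ord_max erefl (fun=> X)) [eta etaP]] := rhoP (in_Hom_dual1 xi).
exists (eta + diff0 rho P (spair P X xi)) => {}Y.
transitivity (spair P Y eta + spair P Y (diff0 rho P (spair P X xi))).
  apply: sectionP => p /=.
  by have := epair_linearr P 1 (Y p) (eta p); rewrite !scale1r => ->.
by rewrite diff0P -etaP ce_diff1E /one_form /= addrAC subrK.
Qed.

End Represent.

(* Main.v *)
Require Import Defs.
From mathcomp Require Import all_boot all_order all_algebra.
From mathcomp Require Import boolp classical_sets functions.
From mathcomp Require Import reals topology normedtype sequences derive.
From mathcomp Require Import realfun exp ring.

Set Implicit Arguments.
Unset Strict Implicit.
Unset Printing Implicit Defensive.

Import Order.TTheory GRing.Theory Num.Theory.
Import numFieldNormedType.Exports.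
Local Open Scope classical_set_scope.
Local Open Scope ring_scope.

(** The bracket has two faces, [u, v] = rho_B (d^A u) v = rho_A (d^B v) u: it is
    a first order differential operator in each argument, and axiom (3) makes
    it skew-symmetric.

    The Jacobi identity then comes from axiom (2). Pairing
    L_(d^A u) X = - [d^B u, X] with d^A v and expanding both sides with the two
    faces of the bracket leaves <X, [d^A u, d^A v]> = rho_A(X) [u, v], that is,
    d^A [u, v] = [d^A u, d^A v] (diff0_bracketE). As rho_B is a representation,
    u |-> rho_B (d^A u) then carries [., .] to commutators; this is the Jacobi
    identity. Composing with the anchor of B instead, the map
    u |-> j (rho_B (d^A u)) preserves brackets.

    The Leibniz rule in v holds because rho_B (d^A u) is a derivation of E with
    symbol a(u) = j (rho_B (d^A u)). What is not automatic is that a(u) depends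
    on u through its value only. Expanding [g w, f v] in two ways gives
    (a(g w) f - g a(w) f) v = (f a(v) g - a(f v) g) w, so if the rank is at
    least 2, choosing v independent of w at a point forces a(g w) = g a(w)
    there (anchorE_tensorial). In rank 1 only locality remains: derivations of E
    do not increase supports (gauge_local), and the bracket is a derivation in
    each argument.

    Passing from sections to fibres and to germs rests on smooth bump functions
    on M (bump_exists), obtained from the flat function exp (-1/x). They provide
    a section through each point of a bundle (section_through), the pointwise
    character of function-linear maps (tensorial_vanish), and locality. *)

(** * Flat functions on the real line *)

Section Flat.
Context {R : realType}.

(** The powers of 1/x make the family closed under differentiation, up to linear
    combinations, so that no iterated derivative has to be computed. *)
Definition flat (m : nat) (x : R) : R :=
  if 0 < x then x^-1 ^+ m * expR (- x^-1) else 0.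

Lemma flat_le0 m x : x <= 0 -> flat m x = 0.
Proof. by rewrite /flat ltNge => ->. Qed.

Lemma flat_gt0 m x : 0 < x -> 0 < flat m x.
Proof.
by move=> x0; rewrite /flat x0 mulr_gt0 ?expR_gt0// exprn_gt0 ?invr_gt0.
Qed.

(** With y = 1/x, this is y ^ (m + 2) <= (m + 2)! exp y, a term of the
    exponential series; it is what makes flat m differentiable at 0. *)
Lemma flat_quadratic m x : `|flat m x| <= m.+2`!%:R * x ^+ 2.
Proof.
have [x0|x0] := leP x 0.
  by rewrite flat_le0// normr0 mulr_ge0// sqr_ge0.
rewrite (ger0_norm (ltW (flat_gt0 m x0))) /flat x0.
set y := x^-1; have y0 : 0 < y by rewrite invr_gt0.
have -> : x = y^-1 by rewrite invrK.
move: y y0 => {x x0} y y0.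
have Ey : y ^+ m.+2 <= m.+2`!%:R * expR y.
  have := expR_ge1Dxn m.+1 (ltW y0).
  set F := m.+2`!%:R; have F0 : 0 < F :> R by rewrite ltr0n fact_gt0.
  rewrite -(ler_pM2l F0); apply: le_trans.
  by rewrite mulrDr mulrCA divff ?gt_eqF// !mulr1 lerDr ltW.
rewrite expRN ler_pdivrMr ?expR_gt0// exprVn mulrAC.
rewrite ler_pdivlMr ?exprn_gt0//.
by rewrite -exprD addn2.
Qed.

Lemma is_derive0_quadratic (f : R -> R) (C : R) :
  (forall x, `|f x| <= C * x ^+ 2) -> is_derive (0 : R) 1 f 0.
Proof.
move=> fC.
have f0 : f 0 = 0.
  by apply/eqP; rewrite -normr_le0; have := fC 0; rewrite expr0n mulr0.
have C0 : 0 <= C.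
  by have := fC 1; rewrite expr1n mulr1; apply: le_trans.
suff H : (fun h => h^-1 *: ((f \o shift 0) (h *: (1 : R)) - f 0)) @ 0^' -->
    (0 : R).
  by split; [apply/cvg_ex; exists 0 | exact: cvg_lim H].
apply/cvgr0Pnorm_le => e e0; rewrite near_withinE.
near=> h => h0.
rewrite /= f0 subr0 addr0 [_ *: 1]mulr1 normrZ normfV ler_pdivrMl ?normr_gt0//.
apply: (le_trans (fC h)); rewrite -real_normK ?num_real// expr2 mulrCA.
rewrite ler_pM2l ?normr_gt0//.
have : `|h| <= e / (C + 1).
  near: h; apply: cvgr0_norm_le; first exact: cvg_id.
  by rewrite divr_gt0// ltr_wpDl.
rewrite ler_pdivlMr ?ltr_wpDl//; apply: le_trans.
by rewrite mulrC ler_wpM2l// lerDl.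
Unshelve. all: by end_near. Qed.

Lemma is_derive_flat m (x : R) :
  is_derive x 1 (flat m) (flat m.+2 x - m%:R * flat m.+1 x).
Proof.
have [x0|x0|->] := ltgtP x 0; last first.
- rewrite !flat_le0// mulr0 subr0.
  exact: is_derive0_quadratic (flat_quadratic m).
- have xn0 : x != 0 by rewrite gt_eqF.
  apply: (@near_eq_is_derive R R R
    (fun y : R => y^-1 ^+ m * expR (- y^-1)) _ x 1).
    near=> y; rewrite /flat ifT//; near: y; exact: lt_nbhsr.
  have dV : is_derive x 1 (fun y : R => y^-1) (- x ^- 2).
    apply: DeriveDef; first exact: (derivableV (f := id)).
    by rewrite (deriveV (f := id))// derive_id [_ *: 1]mulr1.
  have dm : is_derive x 1 ((fun y : R => y^-1) ^+ m)
      ((m%:R * x^-1 ^+ m.-1) *: - x ^- 2) by exact: is_deriveX.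
  have dN : is_derive x 1 (fun y : R => - y^-1) (x ^- 2).
    by have := is_deriveN dV; rewrite opprK.
  have de := is_derive1_comp (g := fun y : R => - y^-1)
    (is_derive_expR (- x^-1)) dN.
  have := is_deriveM dm de.
  have -> : ((fun y : R => y^-1) ^+ m) = (fun y : R => y^-1 ^+ m).
    by apply/funext => y; rewrite exprfctE.
  move=> H; apply: is_derive_eq H _; rewrite /flat x0 /= /GRing.scale /=.
  rewrite -exprVn; set e := expR _; set y := x^-1.
  case: m {dm} => [|m]; rewrite /= ?exprS; ring.
- rewrite !flat_le0 ?(ltW x0)// mulr0 subr0.
  apply: (@near_eq_is_derive R R R (cst 0) _ x 1).
  by near=> y; rewrite /= flat_le0// ltW//; near: y; exact: lt_nbhsl.
Unshelve. all: by end_near. Qed.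

Lemma continuous_flat m : continuous (flat m).
Proof.
move=> x; apply/differentiable_continuous/derivable1_diffP.
exact: (@ex_derive _ _ _ _ _ _ _ (is_derive_flat m x)).
Qed.

End Flat.

(** * Stability of the classes C^k *)

Section CkComp.
Context {R : realType} {n : nat}.
Implicit Types (U V : set 'rV[R]_n) (f g : 'rV[R]_n -> R).

Lemma derive_line f x v : 'D_v f x = 'D_1 (fun t : R => f (t *: v + x)) 0.
Proof.
rewrite /derive; set g1 := fun h => h^-1 *: _; set g2 := fun h => h^-1 *: _.
suff -> : g1 = g2 by [].
by apply/funext => h; rewrite /g1 /g2 /= addr0 scale0r add0r [_%:A]mulr1.
Qed.

(** The chain rule with a merely directionally differentiable inner function,
    by restriction to the line through x with direction v. *)
Lemma is_derive_comp_real (h : R -> R) (dh : R) g x v :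
  is_derive (g x) 1 h dh -> derivable g x v ->
  is_derive x v (h \o g) (dh * 'D_v g x).
Proof.
move=> hd /[dup] gd /derivable1P gd'.
have := @is_derive1_comp R h (fun t => g (t *: v + x)) 0 dh ('D_v g x).
rewrite scale0r add0r => /(_ hd) /=.
case=> [|e1 e2].
  by apply: DeriveDef; rewrite -?derive_line.
apply: DeriveDef; first exact/derivable1P.
by rewrite derive_line.
Qed.

(** The induction on k needs all m at once: differentiating flat m o g gives
    (flat (m + 2) o g - m flat (m + 1) o g) times a partial derivative of g. *)
Lemma Ck_flat k U m g : open U -> Ck k U g -> Ck k U (flat m \o g).
Proof.
move=> oU; elim: k m g => [|k IH] m g Hg; have [gc gk] := Hg.
  split=> // x Ux.
  by apply: continuous_comp; [exact: gc | exact: continuous_flat].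
split=> [x Ux|i].
  by apply: continuous_comp; [exact: gc | exact: continuous_flat].
have [gd gi] := gk i.
have df x (Ux : U x) := is_derive_comp_real (is_derive_flat m (g x)) (gd x Ux).
split=> [x Ux|]; first exact: (@ex_derive _ _ _ _ _ _ _ (df x Ux)).
pose df' x := (flat m.+2 (g x) + - m%:R * flat m.+1 (g x)) * partial i g x.
apply: (@Ck_ext _ _ _ _ df' _ oU) => [x Ux|].
  rewrite /df' /partial mulNr; apply/esym.
  exact: (@derive_val _ _ _ _ _ _ _ (df x Ux)).
apply: Ck_mul => //; have Hg' := Ck_pred Hg.
apply: Ck_add => //; first exact: IH.
by apply: Ck_mul => //; [exact: Ck_cst | exact: IH].
Qed.

Lemma CkU k U V f : Ck k U f -> Ck k V f -> Ck k (U `|` V) f.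
Proof.
elim: k f => [|k IH] f /= [fU dU] [fV dV].
  by split=> // x [/fU|/fV].
split=> [x [/fU|/fV]//|i]; have [dU1 dU2] := dU i; have [dV1 dV2] := dV i.
by split=> [x [/dU1|/dV1]//|]; exact: IH.
Qed.

Lemma Ck_sum (I : Type) (r : seq I) k U (F : I -> 'rV[R]_n -> R) : open U ->
  (forall i, Ck k U (F i)) -> Ck k U (fun x => \sum_(i <- r) F i x).
Proof.
move=> oU FU; elim: r => [|i r IH].
  rewrite (_ : (fun x => _) = fun=> 0); first exact: Ck_cst.
  by apply/funext => x; rewrite big_nil.
rewrite (_ : (fun x => _) = fun x => F i x + \sum_(j <- r) F j x).
  exact: Ck_add.
by apply/funext => x; rewrite big_cons.
Qed.

End CkComp.

(** * Bump functions on a manifold *)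

Section Bump.
Context {R : realType} {n : nat} {M : manifold R n}.

Lemma smooth_onU (U V : set M) (f : M -> R) :
  smooth_on U f -> smooth_on V f -> smooth_on (U `|` V) f.
Proof.
move=> fU fV c ac k; rewrite preimage_setU setIUr.
by apply: CkU; [exact: fU | exact: fV].
Qed.

Lemma smooth_on_ext (U : set M) (f g : M -> R) : open U ->
  (forall p, U p -> f p = g p) -> smooth_on U f -> smooth_on U g.
Proof.
move=> oU fg fU c ac k; apply: Ck_ext (fU c ac k); first exact: chart_open.
by move=> x [_ /fg].
Qed.

Lemma smooth_on_flat (U : set M) m (f : M -> R) : open U ->
  smooth_on U f -> smooth_on U (flat m \o f).
Proof.
by move=> oU fU c ac k; apply: Ck_flat (fU c ac k); exact: chart_open.
Qed.

Lemma smooth_on_sum (I : Type) (r : seq I) (U : set M) (F : I -> M -> R) :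
  open U ->
  (forall i, smooth_on U (F i)) -> smooth_on U (fun p => \sum_(i <- r) F i p).
Proof.
move=> oU FU c ac k.
apply: (Ck_sum r (F := fun i x => F i (chart_inv c x)) (chart_open oU)) => i.
exact: FU.
Qed.

Lemma smooth_on_coord (c : chart R n M) i : atlas c ->
  smooth_on (chart_dom c) (fun p => chart_map c p 0 i).
Proof. by move=> ac c' ac'; exact: (atlas_compat ac' ac). Qed.

(** e^2 - |x - x0|^2 in the chart: positive at the centre, and nonpositive outside
    the box of half-width e, which is all that the cutoff needs. It is spelled
    with sums and products only, to which the closure lemmas apply. *)
Definition cap (c : chart R n M) (x0 : 'rV[R]_n) (e : R) (p : M) : R :=
  e ^+ 2 + (-1) * \sum_i (chart_map c p 0 i - x0 0 i) *
                          (chart_map c p 0 i - x0 0 i).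

(** The function flat 0 o cap, extended by 0 outside the chart, and scaled. It
    vanishes off the image K of a compact box, which is closed since M is
    Hausdorff; this closedness is what makes the extension smooth. *)
Lemma bump_exists (U : set M) (p : M) : open U -> U p ->
  exists (f : 'C^oo M) (K : set M),
    [/\ f p = 1, closed K, K `<=` U & forall q, ~ K q -> f q = 0].
Proof.
move=> oU Up; have [c ac cp] := atlas_cover p.
set x0 := chart_map c p.
have [e e0 eU] : exists2 e : R, 0 < e &
    forall x : 'rV[R]_n, (forall i, `|x 0 i - x0 0 i| <= e) ->
      chart_img c x /\ U (chart_inv c x).
  have : nbhs x0 (chart_img c `&` chart_inv c @^-1` U).
    apply: open_nbhs_nbhs; split; first exact: chart_open.
    by split; [exact: chart_map_img | rewrite /= chart_mapK].
  move=> /nbhs_ballP[e /= e0 He]; exists (e / 2); first by rewrite divr_gt0.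
  (* The radius is halved because the box is closed and the ball open. *)
  move=> x Hx; apply: He; split=> // i j; rewrite (ord1 i) /ball /= distrC.
  by apply: le_lt_trans (Hx j) _; rewrite ltr_pdivrMr// ltr_pMr// ltr1n.
pose box := [set x : 'rV[R]_n |
  forall i, x ord0 i \in `[x0 0 i - e, x0 0 i + e]].
have boxP x : box x <-> forall i, `|x 0 i - x0 0 i| <= e.
  by split=> + i => /(_ i); rewrite in_itv/= ler_distl.
have cbox : compact box.
  apply: (@rV_compact R n (fun i => [set` `[x0 0 i - e, x0 0 i + e]])) => i.
  exact: segment_compact.
pose K := chart_inv c @` box.
have cK : closed K.
  apply: compact_closed; first exact: mfd_hausdorff.
  apply: continuous_compact cbox; apply: continuous_in_subspaceT => x.
  by rewrite inE => /boxP/eU[xc _]; exact: chart_inv_cont.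
have KU : K `<=` U by move=> q [x /boxP/eU[_ Ux] <-].
have Kc : K `<=` chart_dom c.
  by move=> q [x /boxP/eU[xc _] <-]; exact: chart_inv_dom.
pose g q := if `[< chart_dom c q >] then flat 0 (cap c x0 e q) else 0.
have gK q : ~ K q -> g q = 0.
  move=> Kq; rewrite /g; case: asboolP => // cq; apply: flat_le0.
  have : ~ box (chart_map c q).
    by move=> bq; apply: Kq; exists (chart_map c q) => //; exact: chart_mapK.
  move=> /boxP/existsNP[i /negP]; rewrite -ltNge => ei.
  rewrite /cap mulN1r subr_le0 (bigD1 i)//= -expr2 -[leLHS]addr0 lerD//.
    rewrite -[leRHS]real_normK ?num_real//.
    by rewrite lerXn2r ?nnegrE ?normr_ge0 ?(ltW e0) ?(ltW ei).
  by apply: sumr_ge0 => j _; rewrite -expr2 sqr_ge0.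
have gs : smooth_on setT g.
  rewrite -[setT](@setUv _ K); apply: smooth_onU; last first.
    apply: (smooth_on_ext (f := fun=> 0)); first exact: closed_openC.
      by move=> q /gK.
    exact: smooth_on_cst.
  apply: (smooth_on_sub Kc); apply: (smooth_on_ext (f := flat 0 \o cap c x0 e)).
  - exact: chart_dom_open.
  - by move=> q cq; rewrite /g asboolT.
  have oc := chart_dom_open c.
  apply: smooth_on_flat => //; apply: smooth_on_add => //.
    exact: smooth_on_cst.
  apply: smooth_on_mul => //; first exact: smooth_on_cst.
  apply: smooth_on_sum => // i.
  have si : smooth_on (chart_dom c) (fun q => chart_map c q 0 i - x0 0 i).
    apply: smooth_on_add => //; [exact: smooth_on_coord | exact: smooth_on_cst].
  exact: smooth_on_mul.
have gp : 0 < g p.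
  rewrite /g asboolT//; apply: flat_gt0.
  rewrite /cap big1 ?mulr0 ?addr0 ?exprn_gt0// => i _.
  by rewrite subrr mulr0.
exists (SmoothFun (smooth_on_mul openT (smooth_on_cst setT (g p)^-1) gs)), K.
split=> //= [|q /gK ->]; last exact: mulr0.
by rewrite mulVf// gt_eqF.
Qed.

End Bump.

(** * Sections of a vector bundle *)

Section Sections.
Context {R : realType} {n : nat} {M : manifold R n} {E : vbundle M}.

Lemma section_sumE (I : Type) (r : seq I) (s : I -> 'Gamma E) p :
  (\sum_(i <- r) s i) p = \sum_(i <- r) s i p.
Proof. by apply: (big_morph (fun u : 'Gamma E => u p)). Qed.

Lemma smooth_funB (f g : 'C^oo M) p : (f - g) p = f p - g p.
Proof. by rewrite /= mulN1r. Qed.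

Lemma sectionB (u v : 'Gamma E) p : (u - v) p = u p - v p.
Proof. by rewrite /= scaleN1r. Qed.

Section Cutoff.
Context {t : trivialization (rank E) E} {chi : 'C^oo M} {K : set M}.
Context (tE : trivs t) (cK : closed K) (Kt : K `<=` triv_dom t).
Context (chiK : forall q, ~ K q -> chi q = 0).

Lemma smooth_on_cutoff (W : set M) (f : M -> R) : open W ->
  smooth_on (triv_dom t `&` W) f -> smooth_on W (fun q => chi q * f q).
Proof.
move=> oW fW; have ot := triv_dom_open t; have oK := closed_openC cK.
apply: (smooth_on_sub (V := (triv_dom t `&` W) `|` ~` K)).
  by move=> q Wq; have [/Kt|] := pselect (K q); [left|right].
apply: smooth_onU.
  apply: smooth_on_mul; [exact: openI| |exact: fW].
  exact: smooth_on_sub (smooth_valP chi).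
apply: (smooth_on_ext (f := fun=> 0)) => //; last exact: smooth_on_cst.
by move=> q /chiK ->; rewrite mul0r.
Qed.

Lemma cutoff_frame_smooth v :
  smooth_section (E := E) (fun q => chi q *: triv_inv t q v).
Proof.
move=> t' tE' i.
rewrite (_ : (fun q => _) =
  fun q => chi q * triv_map t' q (triv_inv t q v) 0 i).
  apply: smooth_on_cutoff; first exact: triv_dom_open.
  exact: trivs_compat.
by apply/funext => q; rewrite linearZ mxE.
Qed.

Definition cutoff_frame v : 'Gamma E := MkSection (cutoff_frame_smooth v).

Lemma cutoff_coord_smooth (u : 'Gamma E) i :
  smooth_on setT (fun q => chi q * triv_map t q (u q) 0 i).
Proof.
apply: smooth_on_cutoff; first exact: openT.
by rewrite setIT; exact: section_valP.
Qed.

Definition cutoff_coord u i : 'C^oo M := SmoothFun (cutoff_coord_smooth u i).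

(** One factor chi extends the coordinates of u to M, the other one the local
    frame; hence the square. *)
Lemma cutoff_decomposition (u : 'Gamma E) : (chi * chi) *: u =
  \sum_i cutoff_coord u i *: cutoff_frame (delta_mx 0 i).
Proof.
apply: sectionP => q; rewrite section_sumE /=.
have [Kq|/chiK ->] := pselect (K q); last first.
  rewrite mul0r scale0r big1 // => i _.
  by rewrite mul0r !scale0r.
rewrite -[in LHS](triv_mapK (Kt Kq) (u q)).
rewrite [in LHS](row_sum_delta (triv_map t q (u q))) linear_sum scaler_sumr.
apply: eq_bigr => i _.
by rewrite linearZ /= !scalerA mulrAC.
Qed.
End Cutoff.

Lemma section_through p (e : E p) : exists s : 'Gamma E, s p = e.
Proof.
have [t tE tp] := @trivs_cover R n M E p.
have [chi [K [chip cK Kt chiK]]] := bump_exists (triv_dom_open t) tp.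
exists (cutoff_frame tE cK Kt chiK (triv_map t p e)).
by rewrite /= chip scale1r triv_mapK.
Qed.

(** Near p, the section u is a combination of sections with coefficients that
    vanish at p. *)
Lemma tensorial_vanish (phi : 'Gamma E -> 'C^oo M) (u : 'Gamma E) p :
  {morph phi : x y / x + y} -> (forall f x, phi (f *: x) = f * phi x) ->
  u p = 0 -> phi u p = 0.
Proof.
move=> phiD phiZ u0.
have phi0 : phi 0 = 0 by rewrite -(scale0r 0) phiZ mul0r.
have [t tE tp] := @trivs_cover R n M E p.
have [chi [K [chip cK Kt chiK]]] := bump_exists (triv_dom_open t) tp.
have := congr1 (fun s => phi s p) (cutoff_decomposition tE cK Kt chiK u).
rewrite (big_morph phi phiD phi0) phiZ /= chip !mul1r => ->.
rewrite (big_morph (fun f : 'C^oo M => f p) (id1 := 0) (op1 := +%R)) //.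
by rewrite big1 // => i _; rewrite phiZ /= u0 linear0 mxE mulr0 mul0r.
Qed.

Lemma nonzero_vector p : (0 < rank E)%N -> exists x : E p, x != 0.
Proof.
move=> r0; have [t tE tp] := @trivs_cover R n M E p.
pose v : 'rV[R]_(rank E) := delta_mx 0 (Ordinal r0).
exists (triv_inv t p v); apply/eqP => /(congr1 (triv_map t p)).
rewrite triv_invK // linear0 => /rowP/(_ (Ordinal r0)).
by rewrite !mxE !eqxx => /eqP; rewrite oner_eq0.
Qed.

Lemma independent_vector p (x : E p) : (2 <= rank E)%N -> x != 0 ->
  exists y : E p, forall a b : R, a *: y = b *: x -> a = 0.
Proof.
move=> r2 x0; have [t tE tp] := @trivs_cover R n M E p.
have : triv_map t p x != 0.
  by apply: contra_neq x0 => tx; rewrite -(triv_mapK tp x) tx linear0.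
move=> /rV0Pn[j xj].
have [k kj] : exists k : 'I_(rank E), k != j.
  apply/existsP; rewrite -[[exists k, _]]negbK negb_exists; apply/forallP => H.
  have : (#|'I_(rank E)| <= 1)%N.
    apply/card_le1_eqP => a b _ _; have := H a; have := H b.
    by rewrite !negbK => /eqP -> /eqP ->.
  by rewrite card_ord leqNgt r2.
exists (triv_inv t p (delta_mx 0 k)) => a b /(congr1 (triv_map t p)).
rewrite !linearZ /= triv_invK // => /rowP H.
have b0 : b = 0.
  move: (H j); rewrite !mxE (eq_sym j) (negbTE kj) andbF mulr0 => /esym/eqP.
  by rewrite mulf_eq0 (negbTE xj) orbF => /eqP.
by have := H k; rewrite !mxE !eqxx b0 mul0r mulr1.
Qed.

End Sections.

(** * Gauge derivations, pairings and anchors *)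

Section Derivations.
Context {R : realType} {n : nat} {M : manifold R n}.

Lemma smooth_cst1 : smooth_cst 1 = 1 :> 'C^oo M. Proof. by []. Qed.

Lemma gaugeD (E : vbundle M) (d : gauge E) : {morph d : u v / u + v}.
Proof.
by move=> u v; have := gauge_linear d 1 u v; rewrite smooth_cst1 !scale1r.
Qed.

Lemma gauge0 (E : vbundle M) (d : gauge E) : d 0 = 0.
Proof. by apply: (addrI (d 0)); rewrite -gaugeD !addr0. Qed.

Lemma gaugeN (E : vbundle M) (d : gauge E) : {morph d : u / - u}.
Proof. by move=> u; apply: (addrI (d u)); rewrite -gaugeD !addrN gauge0. Qed.

Lemma gauge_leibniz (E : vbundle M) (d : gauge E) f u :
  d (f *: u) = f *: d u + symbol d f *: u.
Proof. exact: svalP (cid (gauge_symbol d)) f u. Qed.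

(** If u vanishes near p, then chi u = 0 for a bump chi at p, and the Leibniz rule
    reduces to 0 = d u p. *)
Lemma gauge_local (E : vbundle M) (d : gauge E) (u : 'Gamma E) p :
  d u p != 0 -> Defs.support u p.
Proof.
move=> dup U; rewrite nbhsE => -[V [oV Vp] VU].
apply: contrapT => nU; case/eqP: dup.
have u0 q : V q -> u q = 0.
  move=> Vq; apply/eqP/negPn/negP => uq; apply: nU; exists q.
  by split=> //; exact: VU.
have [chi [K [chip _ KV chiK]]] := bump_exists oV Vp.
have chiu : chi *: u = 0.
  apply: sectionP => q /=; have [/KV/u0 ->|/chiK ->] := pselect (K q).
    exact: scaler0.
  exact: scale0r.
have := gauge_leibniz d chi u; rewrite chiu gauge0.
move=> /(congr1 (fun s : 'Gamma E => s p)) /=.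
by rewrite chip u0 // scaler0 addr0 scale1r.
Qed.

(** Nondegeneracy is a condition on fibres; sections through every point of A
    transfer it to global sections. *)
Lemma spair_inj (A B E : vbundle M) (P : edual A B E) (xi eta : 'Gamma B) :
  (forall X, spair P X xi = spair P X eta) -> xi = eta.
Proof.
move=> H; apply: sectionP => p; apply/eqP; rewrite -subr_eq0; apply/eqP.
apply: (epair_nondegr (e := P)) => x; have [X <-] := section_through x.
have /(congr1 (fun s : 'Gamma E => s p)) /= e := H X.
have := epair_linearr P (-1) (X p) (eta p) (xi p).
by rewrite !scaleN1r addrC => ->; rewrite e addNr.
Qed.

Lemma spairNl (A B E : vbundle M) (P : edual A B E) X xi :
  spair P (- X) xi = - spair P X xi.
Proof.
apply: sectionP => p /=; set y := xi p; set x := X p.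
have epair0 : epair P 0 y = 0.
  by have := epair_linearl P (-1) x x y; rewrite !scaleN1r !addNr.
by have := epair_linearl P (-1) x 0 y; rewrite epair0 !addr0.
Qed.

Lemma spairDr (A B E : vbundle M) (P : edual A B E) X xi eta :
  spair P X (xi + eta) = spair P X xi + spair P X eta.
Proof.
apply: sectionP => p /=.
by have := epair_linearr P 1 (X p) (xi p) (eta p); rewrite !scale1r.
Qed.

Lemma anchorD (A : lie_algebroid M) (X Y : 'Gamma A) f :
  anchor (X + Y) f = anchor X f + anchor Y f.
Proof.
case: (la_axioms A) => _ [a_ [a_lin a_val]] _ _; apply: smooth_funP => p /=.
by rewrite !a_val; have := a_lin p 1 (X p) (Y p) f; rewrite scale1r mul1r.
Qed.

(** The value on a fibre element is that on any section through it; by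
    tensoriality the choice does not matter. *)
Lemma tensorial_bundle_map_to_TM (E : vbundle M)
    (a : 'Gamma E -> vector_field M) :
  (forall X Y f, a (X + Y) f = a X f + a Y f) ->
  (forall g X f, a (g *: X) f = g * a X f) ->
  bundle_map_to_TM a.
Proof.
move=> aD aZ.
have ext p (x : E p) := cid (section_through x).
have av (X Y : 'Gamma E) f p : X p = Y p -> a X f p = a Y f p.
  move=> XY; apply/eqP; rewrite -subr_eq0; apply/eqP.
  have -> : a X f p - a Y f p = a (X - Y) f p.
    by rewrite -[- Y]scaleN1r aD aZ mulN1r smooth_funB.
  apply: (tensorial_vanish (phi := fun X => a X f)) => //.
  by rewrite sectionB XY subrr.
unshelve eexists.
  move=> p x; pose X := sval (ext p x).
  exists (fun f => a X f p) => [c f g|f g].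
    by rewrite vf_linear.
  by rewrite vf_leibniz.
split=> [p c x y f|X f p] /=; last by apply: av; rewrite (svalP (ext p _)).
transitivity (a (smooth_cst c *: sval (ext p x) + sval (ext p y)) f p).
  by apply: av; rewrite /= !(svalP (ext p _)).
by rewrite aD aZ.
Qed.

End Derivations.

(** * The bracket of an E-Lie bialgebroid *)

Section Main.
Context {R : realType} {n : nat} {M : manifold R n}.
Context {E : vbundle M} {A B : lie_algebroid M} {P : edual A B E}.
Context {rhoA : representation A E} {rhoB : representation B E}.
Context (bialg : E_Lie_bialgebroid P rhoA rhoB).

Local Notation dA := (diff0 rhoA P).
Local Notation dB := (diff0 rhoB (edual_flip P)).
Local Notation br := (bracketE P rhoA rhoB).

Fact invA : invariant_rep rhoA P. Proof. by case: bialg => -[]. Qed.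
Fact invB : invariant_rep rhoB (edual_flip P). Proof. by case: bialg => -[]. Qed.

Lemma bracketE_rhoA u v : br u v = rhoA (dB v) u.
Proof. exact: (diff0P invA). Qed.

Lemma bracketE_rhoB u v : br u v = rhoB (dA u) v.
Proof. exact: (diff0P invB). Qed.

Lemma bracketExx u : br u u = 0.
Proof. by case: bialg => _ _ _; exact. Qed.

Lemma bracketEDl u v w : br (u + v) w = br u w + br v w.
Proof. by rewrite !bracketE_rhoA gaugeD. Qed.

Lemma bracketEDr u v w : br u (v + w) = br u v + br u w.
Proof. by rewrite !bracketE_rhoB gaugeD. Qed.

Lemma bracketE_skew u v : br u v = - br v u.
Proof.
apply/eqP; rewrite -addr_eq0; apply/eqP.
have := bracketExx (u + v).
by rewrite bracketEDl !bracketEDr !bracketExx add0r addr0.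
Qed.

(** Axiom (2) paired with d^A v. After substituting rho_B (d^A u) = [u, .] and
    rho_A (d^B u) = - [u, .], the terms [u, rho_A(X) v] on the two sides cancel. *)
Lemma diff0_bracketE u v : dA (br u v) = la_bracket (dA u) (dA v).
Proof.
apply: (spair_inj (P := P)) => X; rewrite (diff0P invA).
have [_ _ compat _] := bialg.
have := congr1 (fun Y => spair P Y (dA v)) (compat X u).
have -> : spair P (lie_dual rhoB (edual_flip P) (dA u) X) (dA v) =
  rhoB (dA u) (spair P X (dA v)) - spair P X (la_bracket (dA u) (dA v)).
  exact: (lie_dualP invB).
have -> : spair P (- la_bracket (dB u) X) (dA v) = - rhoA (la_bracket (dB u) X) v.
  by rewrite spairNl (diff0P invA).
rewrite (diff0P invA) -bracketE_rhoB rep_bracket -!bracketE_rhoA.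
rewrite [br u (rhoA X v)]bracketE_skew [br u v]bracketE_skew => H.
by move: H; rewrite gaugeN opprB addrC => /addIr <-; rewrite opprK.
Qed.

Lemma bracketE_jacobi u v w :
  br u (br v w) + br v (br w u) + br w (br u v) = 0.
Proof.
rewrite [br w (br u v)]bracketE_skew [br (br u v) w]bracketE_rhoB diff0_bracketE.
rewrite rep_bracket -!bracketE_rhoB [br w u]bracketE_skew.
by rewrite [br v (- _)]bracketE_rhoB gaugeN -bracketE_rhoB subrr.
Qed.

Lemma bracketE_lie : lie_bracket br.
Proof.
split=> [c u v w|c u v w|u|u v w].
- by rewrite !bracketE_rhoA gauge_linear.
- by rewrite !bracketE_rhoB gauge_linear.
- exact: bracketExx.
- exact: bracketE_jacobi.
Qed.

Lemma bracketE_local : local_lie_algebra br.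
Proof.
split=> [|u v]; first exact: bracketE_lie.
have sub w : [set p | br u v p != 0] `<=` Defs.support w ->
    Defs.support (br u v) `<=` Defs.support w.
  have cl : closed (Defs.support w) by exact: closed_closure.
  by move=> /closure_subset; rewrite -((closure_id _).1 cl).
move=> p pS; split.
- by apply: sub pS => q; rewrite bracketE_rhoA; exact: gauge_local.
- by apply: sub pS => q; rewrite bracketE_rhoB; exact: gauge_local.
Qed.

Local Notation aE := (anchorE P rhoA rhoB).

Lemma anchorE_diff0 u f : aE u f = anchor (dA u) f.
Proof. by rewrite /anchorE rep_anchor rep_star_jet. Qed.

Lemma bracketE_leibniz u f v : br u (f *: v) = f *: br u v + aE u f *: v.
Proof. by rewrite anchorE_diff0 !bracketE_rhoB gauge_leibniz rep_anchor. Qed.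

Lemma bracketE_leibnizl u f v : br (f *: u) v = f *: br u v - aE v f *: u.
Proof.
by rewrite bracketE_skew bracketE_leibniz opprD -scalerN -bracketE_skew.
Qed.

Lemma anchorED u v f : aE (u + v) f = aE u f + aE v f.
Proof.
rewrite !anchorE_diff0 -anchorD; congr (anchor _ f).
by apply: (spair_inj (P := P)) => X; rewrite spairDr !(diff0P invA) gaugeD.
Qed.

Lemma anchorE_morphism u v f : aE (br u v) f = aE u (aE v f) - aE v (aE u f).
Proof.
rewrite !anchorE_diff0 diff0_bracketE.
by case: (la_axioms B) => _ _ ->.
Qed.

(** At a point where v and w are independent, both coefficients in the equality of
    the two expansions of [g w, f v] vanish; this is where the rank enters. *)
Lemma anchorE_tensorial g u f : (2 <= rank E)%N -> aE (g *: u) f = g * aE u f.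
Proof.
move=> r2; apply: smooth_funP => p.
have nz (w : 'Gamma E) : w p != 0 -> aE (g *: w) f p = g p * aE w f p.
  move=> wp; have [y yw] := independent_vector r2 wp.
  have [v vp] := section_through y.
  (* Both sides come from [g w, f v], expanded in v first or in w first. *)
  have e : (aE (g *: w) f - g * aE w f) *: v =
      (f * aE v g - aE (f *: v) g) *: w.
    have := bracketE_leibniz (g *: w) f v.
    rewrite !bracketE_leibnizl bracketE_leibniz !scalerBr !scalerDr !scalerA => H.
    move: H; rewrite [f * g]mulrC -!addrA => /addrI H.
    rewrite !scalerBl; apply/eqP; rewrite subr_eq -addrA [- _ + _]addrC H.
    by rewrite addrA subrr add0r.
  have Fp : (aE (g *: w) f - g * aE w f) p = 0.
    apply: (yw _ ((f * aE v g - aE (f *: v) g) p)); rewrite -vp.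
    exact: (congr1 (fun s : 'Gamma E => s p) e).
  apply/eqP; rewrite -subr_eq0 -[X in _ - X]/((g * aE w f) p).
  by rewrite -smooth_funB Fp.
have [up|] := eqVneq (u p) 0; last exact: nz.
(* Where u vanishes, compare u + w and w, which have the same nonzero value. *)
have [x x0] := nonzero_vector p (ltnW r2).
have [w wx] := section_through x.
have := nz (u + w); rewrite scalerDr !anchorED /= (nz w) ?wx // mulrDr up add0r.
by move=> /(_ x0)/addIr.
Qed.

Lemma bracketE_lie_algebroid : (2 <= rank E)%N -> is_lie_algebroid br aE.
Proof.
move=> r2; split.
- exact: bracketE_lie.
- apply: tensorial_bundle_map_to_TM => [u v f|g u f]; first exact: anchorED.
  exact: anchorE_tensorial.
- exact: anchorE_morphism.
- by move=> u v f; exact: bracketE_leibniz.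
Qed.

End Main.

Theorem theorem6p6 (R : realType) (n : nat) (M : manifold R n)
    (E : vbundle M) (A B : lie_algebroid M) (P : edual A B E)
    (rhoA : representation A E) (rhoB : representation B E) :
  E_Lie_bialgebroid P rhoA rhoB ->
  ((2 <= rank E)%N ->
     is_lie_algebroid (bracketE P rhoA rhoB) (anchorE P rhoA rhoB)) /\
  (rank E = 1%N -> local_lie_algebra (bracketE P rhoA rhoB)).
Proof.
move=> bialg; split=> [r2|_]; first exact: bracketE_lie_algebroid.
exact: bracketE_local.
Qed.
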